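(* For a functional PTS specification with EPTS and Dedukti encoding, for all EPTS terms $M,N$: (1) if $[\![M]\!]\hookrightarrow^*_{\beta\mathscr R_{EPTS}}[\![N]\!]$ then $M\hookrightarrow^*N$ in the EPTS; (2) if $[\![M]\!]\equiv[\![N]\!]$ in Dedukti then $M\equiv N$ in the EPTS.
   Context: Functional PTS specification $(\mathcal S,\mathcal A,\mathcal R)$. EPTS terms $x\mid s\mid\Pi_{s_1,s_2}(A,x.B)\mid\lambda_{s_1,s_2}(A,x.B,x.M)\mid@_{s_1,s_2}(A,x.B,M,N)$; EPTS reduction is the context closure of $@_{s_1,s_2}(A,x.B,\lambda_{s_1,s_2}(A',x.B',x.M),N)\hookrightarrow M\{N/x\}$, $\equiv$ its equivalence. Dedukti reduction $\hookrightarrow_{\beta\mathscr R_{EPTS}}$: $\beta$ plus context/substitution closure of the rules $\mathbf{El}_{s_2}\mathbf u_{s_1}\hookrightarrow\mathbf U_{s_1}$ ($(s_1,s_2)\in\mathcal A$) and $\mathbf{app}_{s_1,s_2}AB(\mathbf{abs}_{s_1,s_2}A'B'M)N\hookrightarrow MN$ ($(s_1,s_2,s_3)\in\mathcal R$); Dedukti $\equiv$ is its equivalence. Translation: $[\![x]\!]=x$, $[\![s]\!]=\mathbf u_s$, $[\![\Pi_{s_1,s_2}(A,x.B)]\!]=\mathbf{Prod}_{s_1,s_2}[\![A]\!](\lambda x:\mathbf{El}_{s_1}[\![A]\!].[\![B]\!])$, $[\![\lambda_{s_1,s_2}(A,x.B,x.M)]\!]=\mathbf{abs}_{s_1,s_2}[\![A]\!](\lambda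 x:\mathbf{El}_{s_1}[\![A]\!].[\![B]\!])(\lambda x:\mathbf{El}_{s_1}[\![A]\!].[\![M]\!])$, $[\![@_{s_1,s_2}(A,x.B,M,N)]\!]=\mathbf{app}_{s_1,s_2}[\![A]\!](\lambda x:\mathbf{El}_{s_1}[\![A]\!].[\![B]\!])[\![M]\!][\![N]\!]$. *)

(* Defs.v *)
(* Terms are de Bruijn terms up to alpha-equivalence, with
   parallel renamings and substitutions; free variables are free indices. *)
From Stdlib Require Import Relations.

Record pts_spec : Type := PtsSpec {
  srt : Type;
  ax : srt -> srt -> Prop;
  rl : srt -> srt -> srt -> Prop
}.

Definition functional_spec (P : pts_spec) : Prop :=
  (forall s1 s2 s2' : srt P, ax P s1 s2 -> ax P s1 s2' -> s2 = s2') /\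
  (forall s1 s2 s3 s3' : srt P,
     rl P s1 s2 s3 -> rl P s1 s2 s3' -> s3 = s3').

Definition scons {T : Type} (t : T) (f : nat -> T) (n : nat) : T :=
  match n with 0 => t | S m => f m end.

Definition up_ren (r : nat -> nat) : nat -> nat :=
  scons 0 (fun n => S (r n)).

(* In [EPi s1 s2 A B], [ELam s1 s2 A B M] and [EApp s1 s2 A B M N], the domain
   [A] is outside the binder, [B] is under one binder; [M] is under one binder
   in [ELam] but not in [EApp]. *)
Inductive eterm (P : pts_spec) : Type :=
| EVar : nat -> eterm P
| ESort : srt P -> eterm P
| EPi : srt P -> srt P -> eterm P -> eterm P -> eterm P
| ELam : srt P -> srt P -> eterm P -> eterm P -> eterm P -> eterm P
| EApp : srt P -> srt P -> eterm P -> eterm P -> eterm P -> eterm P -> eterm P.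

Arguments EVar {P} _.
Arguments ESort {P} _.
Arguments EPi {P} _ _ _ _.
Arguments ELam {P} _ _ _ _ _.
Arguments EApp {P} _ _ _ _ _ _.

Fixpoint eren {P : pts_spec} (r : nat -> nat) (t : eterm P) : eterm P :=
  match t with
  | EVar n => EVar (r n)
  | ESort s => ESort s
  | EPi s1 s2 A B => EPi s1 s2 (eren r A) (eren (up_ren r) B)
  | ELam s1 s2 A B M =>
      ELam s1 s2 (eren r A) (eren (up_ren r) B) (eren (up_ren r) M)
  | EApp s1 s2 A B M N =>
      EApp s1 s2 (eren r A) (eren (up_ren r) B) (eren r M) (eren r N)
  end.

Definition eup {P : pts_spec} (f : nat -> eterm P) : nat -> eterm P :=
  scons (EVar 0) (fun n => eren S (f n)).

Fixpoint esubst {P : pts_spec} (f : nat -> eterm P) (t : eterm P) : eterm P :=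
  match t with
  | EVar n => f n
  | ESort s => ESort s
  | EPi s1 s2 A B => EPi s1 s2 (esubst f A) (esubst (eup f) B)
  | ELam s1 s2 A B M =>
      ELam s1 s2 (esubst f A) (esubst (eup f) B) (esubst (eup f) M)
  | EApp s1 s2 A B M N =>
      EApp s1 s2 (esubst f A) (esubst (eup f) B) (esubst f M) (esubst f N)
  end.

Definition esubst1 {P : pts_spec} (M N : eterm P) : eterm P :=
  esubst (scons N EVar) M.

(* The annotations [A], [B] of the application and [A'], [B'] of the
   abstraction are unrelated, so that the rule is left-linear. *)
Inductive estep {P : pts_spec} : eterm P -> eterm P -> Prop :=
| estep_beta s1 s2 A B A' B' M N :
    estep (EApp s1 s2 A B (ELam s1 s2 A' B' M) N) (esubst1 M N)
| estep_pi_dom s1 s2 A A' B :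
    estep A A' -> estep (EPi s1 s2 A B) (EPi s1 s2 A' B)
| estep_pi_cod s1 s2 A B B' :
    estep B B' -> estep (EPi s1 s2 A B) (EPi s1 s2 A B')
| estep_lam_dom s1 s2 A A' B M :
    estep A A' -> estep (ELam s1 s2 A B M) (ELam s1 s2 A' B M)
| estep_lam_cod s1 s2 A B B' M :
    estep B B' -> estep (ELam s1 s2 A B M) (ELam s1 s2 A B' M)
| estep_lam_body s1 s2 A B M M' :
    estep M M' -> estep (ELam s1 s2 A B M) (ELam s1 s2 A B M')
| estep_app_dom s1 s2 A A' B M N :
    estep A A' -> estep (EApp s1 s2 A B M N) (EApp s1 s2 A' B M N)
| estep_app_cod s1 s2 A B B' M N :
    estep B B' -> estep (EApp s1 s2 A B M N) (EApp s1 s2 A B' M N)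
| estep_app_fun s1 s2 A B M M' N :
    estep M M' -> estep (EApp s1 s2 A B M N) (EApp s1 s2 A B M' N)
| estep_app_arg s1 s2 A B M N N' :
    estep N N' -> estep (EApp s1 s2 A B M N) (EApp s1 s2 A B M N').

Definition ered {P : pts_spec} : eterm P -> eterm P -> Prop :=
  clos_refl_trans (eterm P) estep.

Definition econv {P : pts_spec} : eterm P -> eterm P -> Prop :=
  clos_refl_sym_trans (eterm P) estep.

(* Constants exist for all sorts, independently of [ax] and [rl], so that the
   translation is total on raw terms. *)
Inductive dconst (P : pts_spec) : Type :=
| cU : srt P -> dconst P
| cEl : srt P -> dconst P
| cu : srt P -> dconst P
| cProd : srt P -> srt P -> dconst P
| cabs : srt P -> srt P -> dconst P
| capp : srt P -> srt P -> dconst P.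

Arguments cU {P} _.
Arguments cEl {P} _.
Arguments cu {P} _.
Arguments cProd {P} _ _.
Arguments cabs {P} _ _.
Arguments capp {P} _ _.

Inductive dterm (P : pts_spec) : Type :=
| DVar : nat -> dterm P
| DConst : dconst P -> dterm P
| DType : dterm P
| DKind : dterm P
| DPi : dterm P -> dterm P -> dterm P
| DLam : dterm P -> dterm P -> dterm P
| DApp : dterm P -> dterm P -> dterm P.

Arguments DVar {P} _.
Arguments DConst {P} _.
Arguments DType {P}.
Arguments DKind {P}.
Arguments DPi {P} _ _.
Arguments DLam {P} _ _.
Arguments DApp {P} _ _.

Fixpoint dren {P : pts_spec} (r : nat -> nat) (t : dterm P) : dterm P :=
  match t with
  | DVar n => DVar (r n)
  | DConst c => DConst c
  | DType => DType
  | DKind => DKind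
  | DPi A B => DPi (dren r A) (dren (up_ren r) B)
  | DLam A M => DLam (dren r A) (dren (up_ren r) M)
  | DApp M N => DApp (dren r M) (dren r N)
  end.

Definition dup {P : pts_spec} (f : nat -> dterm P) : nat -> dterm P :=
  scons (DVar 0) (fun n => dren S (f n)).

Fixpoint dsubst {P : pts_spec} (f : nat -> dterm P) (t : dterm P) : dterm P :=
  match t with
  | DVar n => f n
  | DConst c => DConst c
  | DType => DType
  | DKind => DKind
  | DPi A B => DPi (dsubst f A) (dsubst (dup f) B)
  | DLam A M => DLam (dsubst f A) (dsubst (dup f) M)
  | DApp M N => DApp (dsubst f M) (dsubst f N)
  end.

Definition dsubst1 {P : pts_spec} (M N : dterm P) : dterm P :=
  dsubst (scons N DVar) M.

Definition dEl {P : pts_spec} (s : srt P) (A : dterm P) : dterm P :=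
  DApp (DConst (cEl s)) A.

Definition dProd {P : pts_spec} (s1 s2 : srt P) (A B : dterm P) : dterm P :=
  DApp (DApp (DConst (cProd s1 s2)) A) B.

Definition dabs {P : pts_spec} (s1 s2 : srt P) (A B M : dterm P) : dterm P :=
  DApp (DApp (DApp (DConst (cabs s1 s2)) A) B) M.

Definition dapp {P : pts_spec} (s1 s2 : srt P) (A B M N : dterm P) : dterm P :=
  DApp (DApp (DApp (DApp (DConst (capp s1 s2)) A) B) M) N.

(* The letters of the two rewrite rules are metavariables standing for
   arbitrary terms, which accounts for closure under substitution. *)
Inductive dstep {P : pts_spec} : dterm P -> dterm P -> Prop :=
| dstep_beta A M N :
    dstep (DApp (DLam A M) N) (dsubst1 M N)
| dstep_El s1 s2 :
    ax P s1 s2 -> dstep (dEl s2 (DConst (cu s1))) (DConst (cU s1))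
| dstep_app_abs s1 s2 s3 A B A' B' M N :
    rl P s1 s2 s3 ->
    dstep (dapp s1 s2 A B (dabs s1 s2 A' B' M) N) (DApp M N)
| dstep_pi_dom A A' B : dstep A A' -> dstep (DPi A B) (DPi A' B)
| dstep_pi_cod A B B' : dstep B B' -> dstep (DPi A B) (DPi A B')
| dstep_lam_dom A A' M : dstep A A' -> dstep (DLam A M) (DLam A' M)
| dstep_lam_body A M M' : dstep M M' -> dstep (DLam A M) (DLam A M')
| dstep_app_fun M M' N : dstep M M' -> dstep (DApp M N) (DApp M' N)
| dstep_app_arg M N N' : dstep N N' -> dstep (DApp M N) (DApp M N').

Definition dred {P : pts_spec} : dterm P -> dterm P -> Prop :=
  clos_refl_trans (dterm P) dstep.

Definition dconv {P : pts_spec} : dterm P -> dterm P -> Prop :=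
  clos_refl_sym_trans (dterm P) dstep.

Fixpoint trans {P : pts_spec} (t : eterm P) : dterm P :=
  match t with
  | EVar n => DVar n
  | ESort s => DConst (cu s)
  | EPi s1 s2 A B =>
      dProd s1 s2 (trans A) (DLam (dEl s1 (trans A)) (trans B))
  | ELam s1 s2 A B M =>
      dabs s1 s2 (trans A)
        (DLam (dEl s1 (trans A)) (trans B))
        (DLam (dEl s1 (trans A)) (trans M))
  | EApp s1 s2 A B M N =>
      dapp s1 s2 (trans A)
        (DLam (dEl s1 (trans A)) (trans B)) (trans M) (trans N)
  end.

(* Main.v *)
(* Every Dedukti reduct of a translated term still represents an EPTS term: the
   relation [repr] below is a functional inverse of the translation which ignores
   the type annotations of Dedukti abstractions and reads the residual beta-redex
   left by a contracted [app]/[abs] pair as the corresponding EPTS substitution.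
   A Dedukti step is then simulated by EPTS reductions on the represented terms,
   which gives reflection of reduction. Reflection of conversion follows from
   confluence of the Dedukti reduction (an orthogonal system, handled with
   parallel reduction): the common reduct represents a common EPTS reduct. *)
From Stdlib Require Import Relations Operators_Properties.
Require Import Defs.

(** * Renamings and substitutions in both syntaxes *)

Section Substitution.
Context {P : pts_spec}.

Lemma up_ren_ext (r r' : nat -> nat) :
  (forall n, r n = r' n) -> forall n, up_ren r n = up_ren r' n.
Proof. intros H [|n]; simpl; auto. Qed.

Lemma eren_ext (t : eterm P) : forall r r' : nat -> nat,
  (forall n, r n = r' n) -> eren r t = eren r' t.
Proof.
  induction t; intros r r' H; simpl; f_equal; auto using up_ren_ext.
Qed.

Lemma eup_ext (f g : nat -> eterm P) :
  (forall n, f n = g n) -> forall n, eup f n = eup g n.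
Proof. intros H [|n]; simpl; f_equal; auto. Qed.

Lemma esubst_ext (t : eterm P) : forall f g : nat -> eterm P,
  (forall n, f n = g n) -> esubst f t = esubst g t.
Proof.
  induction t; intros f g H; simpl; f_equal; auto using eup_ext.
Qed.

Lemma esubst_EVar (t : eterm P) : forall f : nat -> eterm P,
  (forall n, f n = EVar n) -> esubst f t = t.
Proof.
  assert (Hup : forall f : nat -> eterm P,
    (forall n, f n = EVar n) -> forall n, eup f n = EVar n).
  { intros f H [|n]; simpl; [|rewrite H]; reflexivity. }
  induction t; intros f H; simpl; f_equal; auto.
Qed.

Lemma eren_eren (t : eterm P) : forall r r' : nat -> nat,
  eren r' (eren r t) = eren (fun n => r' (r n)) t.
Proof.
  induction t; intros r r'; simpl; f_equal; auto;
    match goal with IH : forall _ _, _ = _ |- _ => rewrite IH end;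
    apply eren_ext; intros [|n]; reflexivity.
Qed.

Lemma esubst_eren (t : eterm P) : forall (r : nat -> nat) (f : nat -> eterm P),
  esubst f (eren r t) = esubst (fun n => f (r n)) t.
Proof.
  induction t; intros r f; simpl; f_equal; auto;
    match goal with IH : forall _ _, _ = _ |- _ => rewrite IH end;
    apply esubst_ext; intros [|n]; reflexivity.
Qed.

Lemma eren_esubst (t : eterm P) : forall (r : nat -> nat) (f : nat -> eterm P),
  eren r (esubst f t) = esubst (fun n => eren r (f n)) t.
Proof.
  induction t; intros r f; simpl; f_equal; auto;
    match goal with IH : forall _ _, _ = _ |- _ => rewrite IH end;
    apply esubst_ext; intros [|n]; simpl; rewrite ?eren_eren; reflexivity.
Qed.

(** Lifting under a binder renames the substitution by [S], so this law rests on the two mixed laws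
    above, and the second of those on the law for two renamings. *)
Lemma esubst_esubst (t : eterm P) : forall f g : nat -> eterm P,
  esubst g (esubst f t) = esubst (fun n => esubst g (f n)) t.
Proof.
  induction t; intros f g; simpl; f_equal; auto;
    match goal with IH : forall _ _, _ = _ |- _ => rewrite IH end;
    apply esubst_ext; intros [|n]; simpl; rewrite ?esubst_eren, ?eren_esubst;
    reflexivity.
Qed.

Lemma eren_esubst1 (r : nat -> nat) (M N : eterm P) :
  eren r (esubst1 M N) = esubst1 (eren (up_ren r) M) (eren r N).
Proof.
  unfold esubst1. rewrite eren_esubst, esubst_eren.
  apply esubst_ext. intros [|n]; reflexivity.
Qed.

Lemma esubst_esubst1 (f : nat -> eterm P) (M N : eterm P) :
  esubst f (esubst1 M N) = esubst1 (esubst (eup f) M) (esubst f N).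
Proof.
  unfold esubst1. rewrite !esubst_esubst.
  apply esubst_ext. intros [|n]; simpl; [reflexivity|].
  (* The shift cancels against [scons], leaving the identity substitution. *)
  rewrite esubst_eren. symmetry. apply esubst_EVar. reflexivity.
Qed.

Lemma dren_ext (t : dterm P) : forall r r' : nat -> nat,
  (forall n, r n = r' n) -> dren r t = dren r' t.
Proof.
  induction t; intros r r' H; simpl; f_equal; auto using up_ren_ext.
Qed.

Lemma dup_ext (f g : nat -> dterm P) :
  (forall n, f n = g n) -> forall n, dup f n = dup g n.
Proof. intros H [|n]; simpl; f_equal; auto. Qed.

Lemma dsubst_ext (t : dterm P) : forall f g : nat -> dterm P,
  (forall n, f n = g n) -> dsubst f t = dsubst g t.
Proof.
  induction t; intros f g H; simpl; f_equal; auto using dup_ext.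
Qed.

Lemma dsubst_DVar (t : dterm P) : forall f : nat -> dterm P,
  (forall n, f n = DVar n) -> dsubst f t = t.
Proof.
  assert (Hup : forall f : nat -> dterm P,
    (forall n, f n = DVar n) -> forall n, dup f n = DVar n).
  { intros f H [|n]; simpl; [|rewrite H]; reflexivity. }
  induction t; intros f H; simpl; f_equal; auto.
Qed.

Lemma dren_dren (t : dterm P) : forall r r' : nat -> nat,
  dren r' (dren r t) = dren (fun n => r' (r n)) t.
Proof.
  induction t; intros r r'; simpl; f_equal; auto;
    match goal with IH : forall _ _, _ = _ |- _ => rewrite IH end;
    apply dren_ext; intros [|n]; reflexivity.
Qed.

Lemma dsubst_dren (t : dterm P) : forall (r : nat -> nat) (f : nat -> dterm P),
  dsubst f (dren r t) = dsubst (fun n => f (r n)) t.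
Proof.
  induction t; intros r f; simpl; f_equal; auto;
    match goal with IH : forall _ _, _ = _ |- _ => rewrite IH end;
    apply dsubst_ext; intros [|n]; reflexivity.
Qed.

Lemma dren_dsubst (t : dterm P) : forall (r : nat -> nat) (f : nat -> dterm P),
  dren r (dsubst f t) = dsubst (fun n => dren r (f n)) t.
Proof.
  induction t; intros r f; simpl; f_equal; auto;
    match goal with IH : forall _ _, _ = _ |- _ => rewrite IH end;
    apply dsubst_ext; intros [|n]; simpl; rewrite ?dren_dren; reflexivity.
Qed.

Lemma dsubst_dsubst (t : dterm P) : forall f g : nat -> dterm P,
  dsubst g (dsubst f t) = dsubst (fun n => dsubst g (f n)) t.
Proof.
  induction t; intros f g; simpl; f_equal; auto;
    match goal with IH : forall _ _, _ = _ |- _ => rewrite IH end;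
    apply dsubst_ext; intros [|n]; simpl; rewrite ?dsubst_dren, ?dren_dsubst;
    reflexivity.
Qed.

Lemma dren_dsubst1 (r : nat -> nat) (M N : dterm P) :
  dren r (dsubst1 M N) = dsubst1 (dren (up_ren r) M) (dren r N).
Proof.
  unfold dsubst1. rewrite dren_dsubst, dsubst_dren.
  apply dsubst_ext. intros [|n]; reflexivity.
Qed.

Lemma dsubst_dsubst1 (f : nat -> dterm P) (M N : dterm P) :
  dsubst f (dsubst1 M N) = dsubst1 (dsubst (dup f) M) (dsubst f N).
Proof.
  unfold dsubst1. rewrite !dsubst_dsubst.
  apply dsubst_ext. intros [|n]; simpl; [reflexivity|].
  rewrite dsubst_dren. symmetry. apply dsubst_DVar. reflexivity.
Qed.

End Substitution.

(** * Congruence and substitutivity of EPTS reduction *)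

Section EPTSReduction.
Context {P : pts_spec}.

Lemma clos_rt_map {A B : Type} (R : relation A) (S : relation B) (f : A -> B) :
  (forall x y, R x y -> S (f x) (f y)) ->
  forall x y, clos_refl_trans A R x y -> clos_refl_trans B S (f x) (f y).
Proof.
  intros Hf x y H.
  induction H; eauto using clos_refl_trans.
Qed.

Lemma ered_EPi s1 s2 (A A' B B' : eterm P) :
  ered A A' -> ered B B' -> ered (EPi s1 s2 A B) (EPi s1 s2 A' B').
Proof.
  intros HA HB. apply rt_trans with (EPi s1 s2 A' B).
  - revert HA. apply clos_rt_map with (f := fun X => EPi s1 s2 X B).
    auto using @estep.
  - revert HB. apply clos_rt_map. auto using @estep.
Qed.

Lemma ered_ELam s1 s2 (A A' B B' M M' : eterm P) :
  ered A A' -> ered B B' -> ered M M' ->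
  ered (ELam s1 s2 A B M) (ELam s1 s2 A' B' M').
Proof.
  intros HA HB HM.
  apply rt_trans with (ELam s1 s2 A' B M);
    [|apply rt_trans with (ELam s1 s2 A' B' M)].
  - revert HA. apply clos_rt_map with (f := fun X => ELam s1 s2 X B M).
    auto using @estep.
  - revert HB. apply clos_rt_map with (f := fun X => ELam s1 s2 A' X M).
    auto using @estep.
  - revert HM. apply clos_rt_map. auto using @estep.
Qed.

Lemma ered_EApp s1 s2 (A A' B B' M M' N N' : eterm P) :
  ered A A' -> ered B B' -> ered M M' -> ered N N' ->
  ered (EApp s1 s2 A B M N) (EApp s1 s2 A' B' M' N').
Proof.
  intros HA HB HM HN.
  apply rt_trans with (EApp s1 s2 A' B M N);
    [|apply rt_trans with (EApp s1 s2 A' B' M N);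
      [|apply rt_trans with (EApp s1 s2 A' B' M' N)]].
  - revert HA. apply clos_rt_map with (f := fun X => EApp s1 s2 X B M N).
    auto using @estep.
  - revert HB. apply clos_rt_map with (f := fun X => EApp s1 s2 A' X M N).
    auto using @estep.
  - revert HM. apply clos_rt_map with (f := fun X => EApp s1 s2 A' B' X N).
    auto using @estep.
  - revert HN. apply clos_rt_map. auto using @estep.
Qed.

Lemma estep_eren (M M' : eterm P) :
  estep M M' -> forall r : nat -> nat, estep (eren r M) (eren r M').
Proof.
  induction 1; intros r; simpl; try rewrite eren_esubst1;
    auto using @estep.
Qed.

Lemma estep_esubst (M M' : eterm P) :
  estep M M' -> forall f : nat -> eterm P, estep (esubst f M) (esubst f M').
Proof.
  induction 1; intros f; simpl; try rewrite esubst_esubst1;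
    auto using @estep.
Qed.

Lemma ered_eup (f g : nat -> eterm P) :
  (forall n, ered (f n) (g n)) -> forall n, ered (eup f n) (eup g n).
Proof.
  intros H [|n]; simpl; [apply rt_refl|].
  generalize (H n). apply clos_rt_map.
  intros x y Hxy. apply estep_eren, Hxy.
Qed.

(** Every copy of a substituted term has to be reduced, so one step in the substitution costs any
    number of steps in the result, possibly none. *)
Lemma ered_esubst_pointwise (M : eterm P) : forall f g : nat -> eterm P,
  (forall n, ered (f n) (g n)) -> ered (esubst f M) (esubst g M).
Proof.
  induction M; intros f g H; simpl;
    auto using rt_refl, ered_EPi, ered_ELam, ered_EApp, ered_eup.
  apply rt_refl.
Qed.

Lemma ered_esubst1 (M M' N N' : eterm P) :
  ered M M' -> ered N N' -> ered (esubst1 M N) (esubst1 M' N').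
Proof.
  intros HM HN. apply rt_trans with (esubst1 M' N).
  - revert HM. apply clos_rt_map with (f := fun X => esubst1 X N).
    intros x y Hxy. apply estep_esubst, Hxy.
  - apply ered_esubst_pointwise. intros [|n]; simpl; [exact HN|apply rt_refl].
Qed.

End EPTSReduction.

(** * Dedukti terms that represent EPTS terms, and simulation of their steps *)

Section Representation.
Context {P : pts_spec}.

(* The annotations [c] and [c'] are unconstrained: they are copies of the domain
   which may reduce independently of it, possibly by the [El] rule. *)
Inductive repr : dterm P -> eterm P -> Prop :=
| repr_var n : repr (DVar n) (EVar n)
| repr_sort s : repr (DConst (cu s)) (ESort s)
| repr_pi s1 s2 a A c b B :
    repr a A -> repr b B ->
    repr (dProd s1 s2 a (DLam c b)) (EPi s1 s2 A B)
| repr_lam s1 s2 a A c b B c' m M :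
    repr a A -> repr b B -> repr m M ->
    repr (dabs s1 s2 a (DLam c b) (DLam c' m)) (ELam s1 s2 A B M)
| repr_app s1 s2 a A c b B m M n N :
    repr a A -> repr b B -> repr m M -> repr n N ->
    repr (dapp s1 s2 a (DLam c b) m n) (EApp s1 s2 A B M N)
| repr_beta c m M n N :
    repr m M -> repr n N -> repr (DApp (DLam c m) n) (esubst1 M N).

Lemma repr_trans (M : eterm P) : repr (trans M) M.
Proof. induction M; simpl; auto using repr. Qed.

(** The shape of [t] leaves at most one applicable clause: residual redexes are headed by [DLam],
    the other composite clauses by different constants. *)
Lemma repr_functional (t : dterm P) (M : eterm P) :
  repr t M -> forall M', repr t M' -> M = M'.
Proof.
  induction 1; intros M' H'; inversion H'; subst; f_equal; auto.
Qed.

Lemma repr_ren (t : dterm P) (M : eterm P) :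
  repr t M -> forall r : nat -> nat, repr (dren r t) (eren r M).
Proof.
  induction 1; intros r; try rewrite eren_esubst1; simpl;
    first [apply repr_pi | apply repr_lam | apply repr_app | constructor]; auto.
Qed.

Lemma repr_up (f : nat -> dterm P) (F : nat -> eterm P) :
  (forall n, repr (f n) (F n)) -> forall n, repr (dup f n) (eup F n).
Proof. intros H [|n]; simpl; [constructor | apply repr_ren, H]. Qed.

(** A residual redex is read as an already performed substitution, so its case rests on
    [esubst_esubst1]. *)
Lemma repr_subst (t : dterm P) (M : eterm P) :
  repr t M -> forall (f : nat -> dterm P) (F : nat -> eterm P),
  (forall n, repr (f n) (F n)) -> repr (dsubst f t) (esubst F M).
Proof.
  induction 1; intros f F H'; try rewrite esubst_esubst1; simpl; auto;
    first [apply repr_pi | apply repr_lam | apply repr_app | constructor];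
    auto using repr_up.
Qed.

Lemma repr_subst1 (m n : dterm P) (M N : eterm P) :
  repr m M -> repr n N -> repr (dsubst1 m n) (esubst1 M N).
Proof.
  intros HM HN. apply repr_subst; [exact HM|].
  intros [|k]; simpl; [exact HN | constructor].
Qed.

Ltac step_inv :=
  repeat match goal with
  | H : dstep (DConst _) _ |- _ => inversion H; clear H
  | H : dstep (DVar _) _ |- _ => inversion H; clear H
  | H : dstep (DLam _ _) _ |- _ => inversion H; clear H; subst
  | H : dstep (DApp _ _) _ |- _ => inversion H; clear H; subst
  end.

(** At the root, an [app]/[abs] contraction is matched by one EPTS beta step, and a Dedukti beta
    step by none, since its redex was already read as the substituted term. Rule [El] can fire only
    inside annotations, which are not read back, so steps there are also matched by none. *)
Lemma repr_step (t : dterm P) (M : eterm P) :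
  repr t M -> forall t', dstep t t' -> exists M', ered M M' /\ repr t' M'.
Proof.
  induction 1; intros t' Ht'; unfold dProd, dabs, dapp in *; step_inv;
    try match goal with
    | IH : forall t', dstep ?t t' -> _, H : dstep ?t _ |- _ =>
        destruct (IH _ H) as (X & HX & HX')
    end;
    try (eexists; split;
      [ first [apply ered_EPi | apply ered_ELam | apply ered_EApp
              | apply ered_esubst1];
        first [eassumption | apply rt_refl]
      | first [apply repr_pi | apply repr_lam | apply repr_app
              | apply repr_beta]; eassumption ]).
  (* The clause for [abs] forces its last argument to be an abstraction, so the contractum is again
     a representable residual redex. *)
  - match goal with H : repr (dabs _ _ _ _ _) M |- _ => inversion H; subst end.
    eexists; split; [apply rt_step, estep_beta|].
    apply repr_beta; assumption.
  - eexists; split; [apply rt_refl|]. apply repr_subst1; assumption.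
Qed.

Lemma repr_dred (t t' : dterm P) :
  dred t t' -> forall M, repr t M -> exists M', ered M M' /\ repr t' M'.
Proof.
  induction 1 as [t t' H | t | t u v _ IH1 _ IH2]; intros M HM.
  - eapply repr_step; eassumption.
  - exists M. split; [apply rt_refl | exact HM].
  - destruct (IH1 _ HM) as (M1 & H1 & R1). destruct (IH2 _ R1) as (M2 & H2 & R2).
    exists M2. split; [|exact R2]. eapply rt_trans; eassumption.
Qed.

End Representation.

(** * Confluence of Dedukti reduction *)

Section Confluence.
Context {P : pts_spec}.

(** Parallel reduction in the style of Tait and Martin-Löf. Type arguments that a rule discards get
    no premise, as they leave no residual. *)
Inductive dpar : dterm P -> dterm P -> Prop :=
| dpar_var n : dpar (DVar n) (DVar n)
| dpar_const c : dpar (DConst c) (DConst c)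
| dpar_type : dpar DType DType
| dpar_kind : dpar DKind DKind
| dpar_pi A A' B B' : dpar A A' -> dpar B B' -> dpar (DPi A B) (DPi A' B')
| dpar_lam A A' M M' : dpar A A' -> dpar M M' -> dpar (DLam A M) (DLam A' M')
| dpar_app M M' N N' : dpar M M' -> dpar N N' -> dpar (DApp M N) (DApp M' N')
| dpar_beta A M M' N N' :
    dpar M M' -> dpar N N' -> dpar (DApp (DLam A M) N) (dsubst1 M' N')
| dpar_El s1 s2 :
    ax P s1 s2 -> dpar (dEl s2 (DConst (cu s1))) (DConst (cU s1))
| dpar_app_abs s1 s2 s3 A B A' B' M M' N N' :
    rl P s1 s2 s3 -> dpar M M' -> dpar N N' ->
    dpar (dapp s1 s2 A B (dabs s1 s2 A' B' M) N) (DApp M' N').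

Lemma dpar_refl (t : dterm P) : dpar t t.
Proof. induction t; constructor; assumption. Qed.

Lemma dstep_dpar (t t' : dterm P) : dstep t t' -> dpar t t'.
Proof. induction 1; eauto using dpar, dpar_refl. Qed.

Lemma dred_DPi (A A' B B' : dterm P) :
  dred A A' -> dred B B' -> dred (DPi A B) (DPi A' B').
Proof.
  intros HA HB. apply rt_trans with (DPi A' B).
  - revert HA. apply clos_rt_map with (f := fun X => DPi X B).
    eauto using @dstep.
  - revert HB. apply clos_rt_map. eauto using @dstep.
Qed.

Lemma dred_DLam (A A' M M' : dterm P) :
  dred A A' -> dred M M' -> dred (DLam A M) (DLam A' M').
Proof.
  intros HA HM. apply rt_trans with (DLam A' M).
  - revert HA. apply clos_rt_map with (f := fun X => DLam X M).
    eauto using @dstep.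
  - revert HM. apply clos_rt_map. eauto using @dstep.
Qed.

Lemma dred_DApp (M M' N N' : dterm P) :
  dred M M' -> dred N N' -> dred (DApp M N) (DApp M' N').
Proof.
  intros HM HN. apply rt_trans with (DApp M' N).
  - revert HM. apply clos_rt_map with (f := fun X => DApp X N).
    eauto using @dstep.
  - revert HN. apply clos_rt_map. eauto using @dstep.
Qed.

(** Together with [dstep_dpar], this gives [dstep] and [dpar] the same reflexive transitive
    closure. *)
Lemma dpar_dred (t t' : dterm P) : dpar t t' -> dred t t'.
Proof.
  induction 1; auto using dred_DPi, dred_DLam, dred_DApp; try apply rt_refl.
  - apply rt_trans with (DApp (DLam A M') N').
    + apply dred_DApp; [apply dred_DLam; [apply rt_refl|]|]; assumption.
    + apply rt_step, dstep_beta.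
  - apply rt_step, dstep_El. assumption.
  - apply rt_trans with (DApp M N).
    + eapply rt_step, dstep_app_abs. eassumption.
    + apply dred_DApp; assumption.
Qed.

Lemma dpar_ren (t t' : dterm P) :
  dpar t t' -> forall r : nat -> nat, dpar (dren r t) (dren r t').
Proof.
  induction 1; intros r; try rewrite dren_dsubst1; simpl;
    solve [eauto using dpar | apply dpar_El; assumption
          | eapply dpar_app_abs; eauto].
Qed.

Lemma dpar_up (f g : nat -> dterm P) :
  (forall n, dpar (f n) (g n)) -> forall n, dpar (dup f n) (dup g n).
Proof. intros H [|n]; simpl; [constructor | apply dpar_ren, H]. Qed.

(** Term and substitution move at once because a parallel beta step puts a reduced argument into a
    reduced body. *)
Lemma dpar_subst (t t' : dterm P) :
  dpar t t' -> forall f g : nat -> dterm P,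
  (forall n, dpar (f n) (g n)) -> dpar (dsubst f t) (dsubst g t').
Proof.
  induction 1; intros f g Hfg; try rewrite dsubst_dsubst1; simpl;
    solve [eauto using dpar, dpar_up | apply dpar_El; assumption
          | eapply dpar_app_abs; eauto].
Qed.

Lemma dpar_subst1 (M M' N N' : dterm P) :
  dpar M M' -> dpar N N' -> dpar (dsubst1 M N) (dsubst1 M' N').
Proof.
  intros HM HN. apply dpar_subst; [exact HM|].
  intros [|n]; simpl; [exact HN | constructor].
Qed.

Lemma dpar_lam_inv (A M t : dterm P) :
  dpar (DLam A M) t ->
  exists A' M', t = DLam A' M' /\ dpar A A' /\ dpar M M'.
Proof. inversion 1; subst; eauto. Qed.

(** The function part of an [app]/[abs] redex is rigid: no rule contracts [capp] with only three
    arguments, nor a term headed by [cabs]. *)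
Lemma dpar_capp_cabs_inv s1 s2 (A B A' B' M t : dterm P) :
  dpar (DApp (DApp (DApp (DConst (capp s1 s2)) A) B) (dabs s1 s2 A' B' M)) t ->
  exists A1 B1 A1' B1' M1,
    t = DApp (DApp (DApp (DConst (capp s1 s2)) A1) B1)
          (dabs s1 s2 A1' B1' M1) /\ dpar M M1.
Proof.
  unfold dabs. intros H.
  repeat match goal with
  | H : dpar (DConst _) _ |- _ => inversion H; clear H; subst
  | H : dpar (DApp _ _) _ |- _ => inversion H; clear H; subst
  end.
  repeat eexists. assumption.
Qed.

(** The left-hand sides do not overlap: a step that does not contract a given redex preserves its
    pattern, which can be contracted afterwards, and two contractions of the same redex are joined
    componentwise. *)
Lemma dpar_diamond (t u : dterm P) :
  dpar t u -> forall v, dpar t v -> exists w, dpar u w /\ dpar v w.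
Proof.
  induction 1 as
    [ | | | | A A' B B' _ IHA _ IHB | A A' M M' _ IHA _ IHM
    | M M' N N' HM IHM HN IHN | A M M' N N' HM IHM HN IHN | s1 s2 Hax
    | s1 s2 s3 A B A' B' M M' N N' Hrl HM IHM HN IHN ]; intros v Hv.
  - inversion Hv; subst. eauto using dpar.
  - inversion Hv; subst. eauto using dpar.
  - inversion Hv; subst. eauto using dpar.
  - inversion Hv; subst. eauto using dpar.
  - inversion Hv; subst.
    edestruct IHA as (? & ? & ?); [eassumption|].
    edestruct IHB as (? & ? & ?); [eassumption|]. eauto using dpar.
  - inversion Hv; subst.
    edestruct IHA as (? & ? & ?); [eassumption|].
    edestruct IHM as (? & ? & ?); [eassumption|]. eauto using dpar.
  - inversion Hv as [ | | | | | | M0 M2 N0 N2 HM2 HN2 | A M0 M2 N0 N2 HM2 HN2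
      | s1 s2 Hax | s1 s2 s3 A B A' B' M0 M2 N0 N2 Hrl HM2 HN2 ]; subst.
    + destruct (IHM _ HM2) as (? & ? & ?). destruct (IHN _ HN2) as (? & ? & ?).
      eauto using dpar.
    + destruct (IHN _ HN2) as (N3 & HN3 & HN3').
      (* The hypothesis speaks of the whole abstraction, so the step of its body is lifted with the
         annotation kept fixed; the inversions then recover a common reduct [M3] of the bodies. *)
      destruct (IHM (DLam A M2)) as (w & Hw1 & Hw2); [eauto using dpar, dpar_refl|].
      destruct (dpar_lam_inv _ _ _ HM) as (A1 & M1 & -> & _ & _).
      destruct (dpar_lam_inv _ _ _ Hw2) as (A3 & M3 & -> & _ & HM3).
      inversion Hw1; subst.
      exists (dsubst1 M3 N3). eauto using dpar, dpar_subst1.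
    (* Constants are fixed by [dpar], so the [El] redex is intact. *)
    + inversion HM; subst. inversion HN; subst.
      eexists. split; [apply dpar_El; assumption | constructor].
    + destruct (IHN _ HN2) as (N3 & HN3 & HN3').
      (* As for beta, the step of the body is lifted to the rigid function part; decomposing [w]
         from both sides yields [M3]. *)
      destruct (IHM (DApp (DApp (DApp (DConst (capp s1 s2)) A) B)
        (dabs s1 s2 A' B' M2))) as (w & Hw1 & Hw2).
      { unfold dabs. repeat apply dpar_app; eauto using dpar_refl. }
      destruct (dpar_capp_cabs_inv _ _ _ _ _ _ _ _ HM)
        as (A1 & B1 & A1' & B1' & M1 & -> & _).
      destruct (dpar_capp_cabs_inv _ _ _ _ _ _ _ _ Hw2)
        as (A3 & B3 & A3' & B3' & M3 & -> & HM3).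
      destruct (dpar_capp_cabs_inv _ _ _ _ _ _ _ _ Hw1)
        as (A4 & B4 & A4' & B4' & M4 & Heq & HM4).
      injection Heq as <- <- <- <- <-.
      exists (DApp M3 N3). split; [eapply dpar_app_abs; eauto | eauto using dpar].
  - inversion Hv as [ | | | | | | M0 M2 N0 N2 HM2 HN2 | A0 M0 M2 N0 N2 HM2 HN2
      | | ]; subst.
    + destruct (dpar_lam_inv _ _ _ HM2) as (A2 & M3 & -> & _ & HM3).
      destruct (IHM _ HM3) as (? & ? & ?). destruct (IHN _ HN2) as (? & ? & ?).
      eauto using dpar, dpar_subst1.
    + destruct (IHM _ HM2) as (? & ? & ?). destruct (IHN _ HN2) as (? & ? & ?).
      eauto using dpar_subst1.
  - exists (DConst (cU s1)). split; [constructor|].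
    inversion Hv as [ | | | | | | M0 M2 N0 N2 HM2 HN2 | | | ]; subst.
    + inversion HM2; subst. inversion HN2; subst. apply dpar_El. assumption.
    + constructor.
  - inversion Hv as [ | | | | | | M0 M2 N0 N2 HM2 HN2 | |
      | s1' s2' s3' A0 B0 A0' B0' M0 M2 N0 N2 Hrl' HM2 HN2 ]; subst.
    + destruct (dpar_capp_cabs_inv _ _ _ _ _ _ _ _ HM2)
        as (A2 & B2 & A2' & B2' & M3 & -> & HM3).
      destruct (IHM _ HM3) as (M4 & ? & ?). destruct (IHN _ HN2) as (N4 & ? & ?).
      exists (DApp M4 N4). split; [eauto using dpar | eapply dpar_app_abs; eauto].
    + destruct (IHM _ HM2) as (? & ? & ?). destruct (IHN _ HN2) as (? & ? & ?).
      eauto using dpar.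
Qed.

(** Strip lemma: along the sequence, each diamond keeps the opposite side a single parallel step. *)
Lemma dpar_dred_strip (t u : dterm P) :
  dred t u -> forall v, dpar t v -> exists w, dpar u w /\ dred v w.
Proof.
  induction 1 as [t u H | t | t u u' _ IH1 _ IH2]; intros v Hv.
  - destruct (dpar_diamond _ _ (dstep_dpar _ _ H) _ Hv) as (w & Huw & Hvw).
    eauto using dpar_dred.
  - exists v. split; [exact Hv | apply rt_refl].
  - destruct (IH1 _ Hv) as (w & Huw & Hvw).
    destruct (IH2 _ Huw) as (w' & Hw1 & Hw2).
    exists w'. split; [exact Hw1 | eapply rt_trans; eassumption].
Qed.

Lemma dred_confluent (t u : dterm P) :
  dred t u -> forall v, dred t v -> exists w, dred u w /\ dred v w.
Proof.
  induction 1 as [t u H | t | t u u' _ IH1 _ IH2]; intros v Hv.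
  (* The roles are exchanged: the strip runs along [Hv], against the single step. *)
  - destruct (dpar_dred_strip _ _ Hv _ (dstep_dpar _ _ H)) as (w & Hvw & Huw).
    eauto using dpar_dred.
  - exists v. split; [exact Hv | apply rt_refl].
  - destruct (IH1 _ Hv) as (w & Huw & Hvw).
    destruct (IH2 _ Huw) as (w' & Hw1 & Hw2).
    exists w'. split; [exact Hw1 | eapply rt_trans; eassumption].
Qed.

Lemma dconv_joinable (t u : dterm P) :
  dconv t u -> exists w, dred t w /\ dred u w.
Proof.
  induction 1 as [t u H | t | t u _ (w & H1 & H2)
    | t u v _ (w1 & H1 & H2) _ (w2 & H3 & H4)].
  - exists u. split; [apply rt_step, H | apply rt_refl].
  - exists t. split; apply rt_refl.
  - eauto.
  (* Confluence closes the peak at the middle term of a transitivity. *)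
  - destruct (dred_confluent _ _ H2 _ H3) as (w & Hw1 & Hw2).
    exists w. split; eapply rt_trans; eassumption.
Qed.

End Confluence.

(** * Reflection of reduction and conversion *)

Lemma ered_econv {P : pts_spec} (M N : eterm P) : ered M N -> econv M N.
Proof. apply clos_rt_clos_rst. Qed.

Theorem mainTheorem14 (P : pts_spec) (HP : functional_spec P) (M N : eterm P) :
  (dred (trans M) (trans N) -> ered M N) /\
  (dconv (trans M) (trans N) -> econv M N).
Proof.
  split; intros H.
  - destruct (repr_dred _ _ H _ (repr_trans M)) as (N' & HN & HR).
    (* [trans N] represents both [N] and the reduct [N'], so the two coincide. *)
    rewrite (repr_functional _ _ (repr_trans N) _ HR). exact HN.
  - destruct (dconv_joinable _ _ H) as (w & HMw & HNw).
    destruct (repr_dred _ _ HMw _ (repr_trans M)) as (M' & HM & HRM).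
    destruct (repr_dred _ _ HNw _ (repr_trans N)) as (N' & HN & HRN).
    (* [w] represents both [M'] and [N'], which are therefore one common EPTS reduct. *)
    rewrite <- (repr_functional _ _ HRM _ HRN) in HN.
    apply rst_trans with M'; [|apply rst_sym]; apply ered_econv; assumption.
Qed.
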